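(* Let $s\ge1$ and $T>0$. Consider a family of linear problems $u'(t)=\sum_{j=0}^s F_j(t,u(t))$, $u(0)=u_0$, $t\in[0,T]$, in $\mathbb{R}^m$, with $F_j(t,v)=A_jv+g_j(t)$ for $j=0,1,\ldots,s$, indexed by a spatial mesh-width $h>0$ (so that $m$, $u_0$, $A_j$, $g_j$ and the norm may depend on $h$), with exact solution $u(t)$, and let $\varphi_j(t)=F_j(t,u(t))$. Let $A=A_0+A_1+\cdots+A_s$ be invertible, and suppose $\varphi_j'(t),\varphi_j''(t)=\mathcal{O}(1)$ for $t\in[0,T]$, $j=0,1,\ldots,s$. Assume that, for the step-sizes $\Delta t>0$ and mesh-widths $h$ under consideration, the following hold. (a) There are constants $L<2$ and $M>0$, independent of $h$ and $\Delta t$, such that $\|\Delta t A_0\|\le L$ and, for $j=1,\ldots,s$, the matrix $I-\frac12\Delta tA_j$ is invertible with $\|(I-\frac12\Delta tA_j)^{-1}\|\le M$. (b) There is a constant $K>0$, independent of $h$ and $\Delta t$, such that $\|R^n\|\le K$ for all $n\ge1$, where $$R=I+Q_s^{-1}\cdots Q_2^{-1}Q_1^{-1}P_0Z,\quad P_0=I+\tfrac12\Delta tA_0,\quad Q_j=I-\tfrac12\Delta tA_j,\quad Z=\Delta t A.$$ (c) $A_0A_j=A_jA_0$ for $j=1,2,\ldots,s$. (d) $A^{-1}A_0\upsilon(t)=\mathcal{O}(1)$ for $\upsilon=u'',u'''$ and $t\in[0,T]$. (e) $\Delta t^{k-1}A^{-1}A_{i_1}A_{i_2}\cdots A_{i_k}\upsilon(t)=\mathcal{O}(1)$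 for $\upsilon=\varphi_j',\varphi_j''$, $t\in[0,T]$, and all indices $1\le i_1<i_2<\cdots<i_k<j\le s$ ($k\ge1$). Let $u_n$, $n\ge1$, be computed, starting from $u_0$, by the modified Douglas method with $t_n=n\Delta t$ and $F=F_0+\cdots+F_s$: $$\begin{aligned} v_*&=u_{n-1}+\Delta t\,F(t_{n-1},u_{n-1}),\\ v_0&=v_*+\tfrac12\Delta t\big(F_0(t_n,v_* )-F_0(t_{n-1},u_{n-1})\big),\\ v_j&=v_{j-1}+\tfrac12\Delta t\big(F_j(t_n,v_j)-F_j(t_{n-1},u_{n-1})\big)\quad(j=1,2,\ldots,s),\\ u_n&=v_s.\end{aligned}$$ Then the method is convergent of order two on the interval $[0,T]$; that is, there is a constant $C$, independent of $h$ and $\Delta t$, such that $\|u(t_n)-u_n\|\le C\Delta t^2$ for all $n$ with $0\le t_n\le T$ and all sufficiently small $\Delta t$ under consideration.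
   Context: $\|\cdot\|$ is a norm on $\mathbb{R}^m$ (one for each $h$), and also denotes the induced matrix norm on $\mathbb{R}^{m\times m}$. $\mathcal{O}(\Delta t^k)$ denotes a vector or matrix whose norm is bounded by $C\Delta t^k$ for small $\Delta t>0$, with a constant $C$ that does not depend on the mesh-width $h$ (nor on $\Delta t$, $t\in[0,T]$ or $n$); in particular $\mathcal{O}(1)$ means bounded uniformly in $h$, $\Delta t$ and $t\in[0,T]$. The functions $\varphi_j$ are assumed twice continuously differentiable on $[0,T]$; since $u'=\sum_{j=0}^s\varphi_j$, $u$ is three times continuously differentiable. For $s=1$ condition (e) is void. *)

(* Defs.v *)
From HB Require Import structures.
From mathcomp Require Import all_boot all_order all_algebra.
From mathcomp Require Import all_classical all_reals all_analysis.
Set Implicit Arguments.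
Unset Strict Implicit.
Unset Printing Implicit Defensive.
Import Order.TTheory GRing.Theory Num.Theory.
Import numFieldNormedType.Exports.
Local Open Scope classical_set_scope.
Local Open Scope ring_scope.

Section Norms.
Variables (R : realType) (m : nat).

(* Nonnegativity follows from these three axioms. *)
Definition is_norm (N : 'cV[R]_m -> R) : Prop :=
  [/\ forall x, N x = 0 -> x = 0,
      forall (a : R) x, N (a *: x) = `|a| * N x
    & forall x y, N (x + y) <= N x + N y].

Definition induced_norm (N : 'cV[R]_m -> R) (B : 'M[R]_m) : R :=
  sup [set N (B *m x) | x in [set x | N x <= 1]].

End Norms.

(* Calculus on the closed interval [0, T]: the difference quotients only use
   points of [0, T], so derivatives at 0 and T are one-sided. The library
   topology on 'cV[R]_m is that of the maximum norm, hence that of any norm. *)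
Section IntervalCalculus.
Variables (R : realType) (m : nat) (T : R).
Implicit Types f : R -> 'cV[R]_m.

Definition diff_quot f (t r : R) : 'cV[R]_m := (r - t)^-1 *: (f r - f t).

Definition derivable_on f : Prop :=
  forall t, 0 <= t <= T -> cvg (diff_quot f t r @[r --> within `[0, T] t^']).

Definition deriv_on f (t : R) : 'cV[R]_m :=
  lim (diff_quot f t r @[r --> within `[0, T] t^']).

Definition twice_cont_diff_on f : Prop :=
  [/\ derivable_on f, derivable_on (deriv_on f)
    & {within `[0, T], continuous (deriv_on (deriv_on f))}].

End IntervalCalculus.

(* An initial value problem u' = sum_(j <= s) (A_j u + g_j), u(0) = u0.
   The splitting index j is a nat for convenience; only j <= s is ever used. *)
Record linear_ivp (R : realType) := LinearIVP {
  ivp_dim : nat;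
  vnorm : 'cV[R]_ivp_dim -> R;
  vnormP : is_norm vnorm;
  coef : nat -> 'M[R]_ivp_dim;
  source : nat -> R -> 'cV[R]_ivp_dim;
  init : 'cV[R]_ivp_dim
}.

Section Problem.
Variables (R : realType) (s : nat) (T : R) (P : linear_ivp R).
Local Notation V := 'cV[R]_(ivp_dim P).

Definition mnorm (B : 'M[R]_(ivp_dim P)) : R := induced_norm (@vnorm R P) B.

Definition Fj (j : nat) (t : R) (v : V) : V := coef P j *m v + source P j t.

Definition Ftotal (t : R) (v : V) : V := \sum_(j < s.+1) Fj j t v.

Definition Atotal : 'M[R]_(ivp_dim P) := \sum_(j < s.+1) coef P j.

Definition phi (u : R -> V) (j : nat) (t : R) : V := Fj j t (u t).

Definition exact_solution (u : R -> V) : Prop :=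
  [/\ u 0 = init P, derivable_on T u
    & forall t, 0 <= t <= T -> deriv_on T u t = Ftotal t (u t)].

Definition P0mx (dt : R) : 'M[R]_(ivp_dim P) :=
  1%:M + (2^-1 * dt) *: coef P 0%N.

Definition Qmx (dt : R) (j : nat) : 'M[R]_(ivp_dim P) :=
  1%:M - (2^-1 * dt) *: coef P j.

Definition Zmx (dt : R) : 'M[R]_(ivp_dim P) := dt *: Atotal.

(* rev (iota 1 s) is s, ..., 2, 1: the factors stand in the order
   Q_s^-1 ... Q_2^-1 Q_1^-1. *)
Definition Rmx (dt : R) : 'M[R]_(ivp_dim P) :=
  1%:M + (\big[mulmx/1%:M]_(j <- rev (iota 1 s)) invmx (Qmx dt j))
           *m P0mx dt *m Zmx dt.

(* One step from w at time t to w' at time t' = t + dt. The stages v_j, j >= 1,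
   are given implicitly, so the step is a relation. *)
Definition douglas_step (dt t t' : R) (w w' : V) : Prop :=
  exists (vstar : V) (v : nat -> V),
  [/\ vstar = w + dt *: Ftotal t w,
      v 0%N = vstar + (2^-1 * dt) *: (Fj 0%N t' vstar - Fj 0%N t w),
      (forall j, (1 <= j <= s)%N ->
         v j = v j.-1 + (2^-1 * dt) *: (Fj j t' (v j) - Fj j t w))
    & w' = v s].

(* Steps are only required as long as they stay inside [0, T], where the
   problem is posed. *)
Definition douglas_sequence (dt : R) (U : nat -> V) : Prop :=
  U 0%N = init P /\
  forall n, (1 <= n)%N -> n%:R * dt <= T ->
    douglas_step dt (n.-1%:R * dt) (n%:R * dt) (U n.-1) (U n).

End Problem.

Section Family.
Variables (R : realType) (s : nat) (T : R).
(* P h is the problem for mesh-width h; adm h dt says that the pair of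
   mesh-width h and step-size dt is under consideration. *)
Variables (P : R -> linear_ivp R) (adm : R -> R -> Prop).

Definition bigO1 (w : forall h : R, R -> R -> 'cV[R]_(ivp_dim (P h))) : Prop :=
  exists C : R, forall h dt t, adm h dt -> 0 <= t <= T ->
    vnorm (w h dt t) <= C.

Definition convergent_order2 (u : forall h : R, R -> 'cV[R]_(ivp_dim (P h))) :
    Prop :=
  exists C dt0 : R, 0 < dt0 /\
  forall h dt, adm h dt -> dt <= dt0 ->
  forall U : nat -> 'cV[R]_(ivp_dim (P h)), douglas_sequence s T dt U ->
  forall n : nat, 0 <= n%:R * dt <= T ->
    vnorm (u h (n%:R * dt) - U n) <= C * dt ^+ 2.

End Family.

(* Main.v *)
(** Let e_n = u(t_n) - u_n. Replacing all stages by u(t_n) leaves residuals, and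
    e_n = R e_(n-1) + d_n with d_n = Q^-1 (tau_n + x_n), Q^-1 = Q_s^-1 ... Q_1^-1,
    where tau_n = O(dt^3) is the residual of the trapezoidal rule and
    x_n = 1/2 dt A_0 rho_* + sum_j (Q_1 ... Q_(j-1) - I) rho_j is only O(dt^2).
    Since A_0 commutes with A, I - R = - Q^-1 P_0 Z gives Q^-1 x_n = (I - R) xi_n
    with xi_n = - P_0^-1 Z^-1 x_n. Expanding the products of the Q_i, conditions
    (d) and (e) yield xi_n = O(dt^2) and xi_n - xi_(n-1) = O(dt^3), while
    ||1/2 dt A_0|| <= L/2 < 1 bounds P_0^-1. Summation by parts and the
    power-boundedness of R then turn the local errors into a global error O(dt^2).
    Derivatives are bounded through a mean value inequality valid for every
    seminorm, applied to x |-> ||B x|| for the matrices B occurring in (d), (e). *)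

Require Import Defs.
From HB Require Import structures.
From mathcomp Require Import all_boot all_order all_algebra.
From mathcomp Require Import all_classical all_reals all_analysis.
From mathcomp Require Import ring lra.
Import Order.TTheory GRing.Theory Num.Theory.
Import numFieldNormedType.Exports.
Local Open Scope classical_set_scope.
Local Open Scope ring_scope.
Set Implicit Arguments.
Unset Strict Implicit.
Unset Printing Implicit Defensive.

(** * Norms *)

(** Definiteness is left out so that [x |-> N (B *m x)] qualifies even for singular [B]. *)
Definition is_seminorm (R : realType) (m : nat) (p : 'cV[R]_m -> R) : Prop :=
  (forall (a : R) x, p (a *: x) = `|a| * p x) /\
  (forall x y, p (x + y) <= p x + p y).

Section Seminorm.
Variables (R : realType) (m : nat) (p : 'cV[R]_m -> R).
Hypothesis sp : is_seminorm p.

Lemma seminormZ (a : R) x : p (a *: x) = `|a| * p x.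
Proof. by case: sp. Qed.

Lemma seminorm0 : p 0 = 0.
Proof. by rewrite -(scale0r (0 : 'cV[R]_m)) seminormZ normr0 mul0r. Qed.

Lemma seminormN x : p (- x) = p x.
Proof. by rewrite -scaleN1r seminormZ normrN normr1 mul1r. Qed.

Lemma seminorm_ge0 x : 0 <= p x.
Proof.
have [_ /(_ x (- x))] := sp.
by rewrite subrr seminorm0 seminormN -mulr2n pmulrn_lge0.
Qed.

Lemma seminorm_leD x y a b : p x <= a -> p y <= b -> p (x + y) <= a + b.
Proof.
have [_ /(_ x y) pD] := sp.
by move=> px py; apply: le_trans pD _; apply: lerD.
Qed.

Lemma seminorm_leB x y a b : p x <= a -> p y <= b -> p (x - y) <= a + b.
Proof. by move=> px py; apply: seminorm_leD; rewrite ?seminormN. Qed.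

Lemma seminorm_sum (I : Type) (r : seq I) (F : I -> 'cV[R]_m) :
  p (\sum_(i <- r) F i) <= \sum_(i <- r) p (F i).
Proof.
elim/big_ind2: _ => [|x a y b px py|//]; first by rewrite seminorm0.
exact: seminorm_leD.
Qed.

Lemma seminorm_mulmx (B : 'M[R]_m) : is_seminorm (fun x => p (B *m x)).
Proof.
have [pZ pD] := sp; split=> [a x|x y]; first by rewrite -scalemxAr pZ.
by rewrite mulmxDr.
Qed.

(** Expand [x] in the unit vectors; [k] is the sum of their seminorms. *)
Lemma seminorm_le_coord :
  exists2 k : R, 0 <= k & forall (x : 'cV[R]_m) (e : R),
    (forall i, `|x i ord0| <= e) -> p x <= k * e.
Proof.
exists (\sum_i p (delta_mx i ord0)) => [|x e xe].
  by apply: sumr_ge0 => i _; exact: seminorm_ge0.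
rewrite {1}[x]matrix_sum_delta.
under eq_bigr do rewrite big_ord_recl big_ord0 addr0.
apply: le_trans (seminorm_sum _ _) _; rewrite mulr_suml.
apply: ler_sum => i _; rewrite seminormZ mulrC.
by apply: ler_wpM2l => //; exact: seminorm_ge0.
Qed.

End Seminorm.

Lemma ler_mx_norm_coord (R : realType) (m n : nat) (x : 'M[R]_(m, n)) i j :
  `|x i j| <= `|x|.
Proof.
rewrite -[leRHS]/(mx_norm x) mx_normrE.
exact: (le_bigmax 0 (fun ij => `|x ij.1 ij.2|) (i, j)).
Qed.

Section Norm.
Variables (R : realType) (m : nat) (N : 'cV[R]_m -> R).
Hypothesis nN : is_norm N.

Lemma is_norm_seminorm : is_seminorm N.
Proof. by case: nN. Qed.

Let sN := is_norm_seminorm.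

(** [N] is Lipschitz by the reverse triangle inequality and [seminorm_le_coord]. Row vectors suit
    the extreme value theorem [EVT_min_rV]. *)
Lemma continuous_norm_trmx : continuous (fun y : 'rV[R]_m => N y^T).
Proof.
have [k k0 kP] := seminorm_le_coord sN.
have lipN (x y : 'cV[R]_m) (e : R) :
    (forall i, `|(x - y) i ord0| <= e) -> `|N x - N y| <= k * e.
  move=> xye; rewrite ler_norml; apply/andP; split.
    have := seminorm_leD sN (lexx (N x)) (lexx (N (y - x))).
    rewrite subrKC -[y - x]opprB (seminormN sN) => NyDx.
    have := kP _ _ xye; lra.
  have := seminorm_leD sN (lexx (N y)) (lexx (N (x - y))).
  rewrite subrKC => NyDx.
  have := kP _ _ xye; lra.
move=> y; apply/(@cvgrPdist_le _ _ _ (nbhs y) (nbhs_filter y)) => e e0.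
have ek0 : 0 < e / (k + 1) by apply: divr_gt0 => //; lra.
near=> z.
have : `|y - z| <= e / (k + 1).
  by near: z; exact: (@cvgr_dist_le _ _ _ (nbhs y) (nbhs_filter y)).
move=> yz; apply: le_trans (lipN _ _ (e / (k + 1)) _) _.
  move=> i; apply: le_trans yz.
  by rewrite -raddfB mxE; exact: ler_mx_norm_coord.
rewrite mulrA ler_pdivrMr; last by lra.
by rewrite mulrC ler_wpM2l ?ltW //; lra.
Unshelve. all: by end_near.
Qed.

(* The minimum of [N] on the compact unit sphere of the maximum norm is positive. *)
Lemma coord_le_norm :
  exists2 k : R, 0 <= k & forall (x : 'cV[R]_m) i, `|x i ord0| <= k * N x.
Proof.
(* An empty unit sphere means dimension 0, where every vector vanishes and [k = 0] serves. *)
have [[y0 y01]|Snone] := pselect (exists y : 'rV[R]_m, `|y| = 1); last first.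
  exists 0 => // x i; rewrite mul0r.
  have [->|xn0] := eqVneq x 0; first by rewrite mxE normr0.
  exfalso; apply: Snone; exists (`|x^T|^-1 *: x^T).
  rewrite normrZ normfV normr_id mulVf // normr_eq0.
  by rewrite -trmx0 (inj_eq trmx_inj).
pose S := [set y : 'rV[R]_m | `|y| = 1].
have S0 : S !=set0 by exists y0.
have Sc : compact S.
  apply: bounded_closed_compact.
    exists 1; split=> // r r1 y; rewrite /S /= => ->; exact: ltW.
  have -> : S = (fun y : 'rV[R]_m => `|y|) @^-1` [set 1] by [].
  apply: closed_comp; last exact: closed_eq.
  by move=> y _; exact: norm_continuous.
have Nc : {within S, continuous (fun y : 'rV[R]_m => N y^T)}.
  exact/continuous_subspaceT/continuous_norm_trmx.
have [c /[!inE] Sc1 cmin] := EVT_min_rV S0 Sc Nc.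
have Nc0 : 0 < N c^T.
  rewrite lt_def (seminorm_ge0 sN) andbT; apply/eqP => Nc0.
  have [N0 _ _] := nN.
  move: Sc1; rewrite /S /= -[c]trmxK (N0 _ Nc0) trmx0 normr0 => /eqP.
  by rewrite eq_sym oner_eq0.
exists (N c^T)^-1 => [|x i]; first by rewrite invr_ge0 ltW.
have [->|xn0] := eqVneq x 0; first by rewrite mxE normr0 (seminorm0 sN) mulr0.
have x0 : 0 < `|x^T| by rewrite normr_gt0 -trmx0 (inj_eq trmx_inj).
apply: (@le_trans _ _ `|x^T|).
  by have := ler_mx_norm_coord x^T ord0 i; rewrite mxE.
have := cmin (`|x^T|^-1 *: x^T).
rewrite inE /S /= normrZ normfV normr_id mulVf ?gt_eqF // => /(_ erefl).
rewrite linearZ /= trmxK (seminormZ sN) normfV normr_id.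
by rewrite ler_pdivlMl // ler_pdivlMl // mulrC.
Qed.

Lemma norm_mulmx_le (B : 'M[R]_m) x : N (B *m x) <= induced_norm N B * N x.
Proof.
have sB := seminorm_mulmx sN B.
have [N0 _ _] := nN.
have [->|xn0] := eqVneq x 0.
  by rewrite mulmx0 (seminorm0 sN) mulr0.
have Nx0 : 0 < N x.
  by rewrite lt_def (seminorm_ge0 sN) andbT; apply: contraNneq xn0 => /N0 ->.
rewrite -ler_pdivrMr // mulrC.
have -> : (N x)^-1 * N (B *m x) = N (B *m ((N x)^-1 *: x)).
  by rewrite -scalemxAr (seminormZ sN) ger0_norm // invr_ge0 ltW.
(* A [sup] dominates its elements only for a bounded set; boundedness comes from comparing with the
   maximum norm in both directions. *)
apply: ub_le_sup; last first.
  exists ((N x)^-1 *: x) => //=.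
  by rewrite (seminormZ sN) normfV (gtr0_norm Nx0) mulVf ?gt_eqF.
have [k k0 kP] := coord_le_norm; have [l l0 lP] := seminorm_le_coord sB.
exists (l * k) => _ [y /= y1 <-]; apply: lP => i.
by apply: le_trans (kP y i) _; rewrite -[leRHS]mulr1 ler_wpM2l.
Qed.

End Norm.

(** * Mean value and Taylor inequalities *)

(* [f] has derivative [f'] on [a, b] (one-sided at the end points), convergence
   of the difference quotients being measured by [p]. *)
Definition has_deriv (R : realType) (m : nat) (p : 'cV[R]_m -> R) (a b : R)
    (f f' : R -> 'cV[R]_m) : Prop :=
  forall c, a <= c <= b -> forall e : R, 0 < e ->
  exists2 d : R, 0 < d & forall r, a <= r <= b -> `|r - c| <= d ->
    p (f r - f c - (r - c) *: f' c) <= e * `|r - c|.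

Section HasDeriv.
Variables (R : realType) (m : nat) (p : 'cV[R]_m -> R).
Hypothesis sp : is_seminorm p.
Implicit Types (a b : R) (f g : R -> 'cV[R]_m).

Lemma has_deriv_eq a b f f' g g' :
  (forall t, a <= t <= b -> f t = g t) ->
  (forall t, a <= t <= b -> f' t = g' t) ->
  has_deriv p a b f f' -> has_deriv p a b g g'.
Proof.
move=> fg fg' hf c cab e e0; have [d d0 hd] := hf c cab e e0.
by exists d => // r rab rd; rewrite -!fg // -fg' //; exact: hd.
Qed.

Lemma has_deriv_sub a b a1 b1 f f' :
  a <= a1 -> b1 <= b -> has_deriv p a b f f' -> has_deriv p a1 b1 f f'.
Proof.
move=> aa1 b1b hf c /andP[ac cb] e e0.
have [|d d0 hd] := hf c _ e e0; first by apply/andP; split; lra.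
exists d => // r /andP[ar rb]; apply: hd; apply/andP; split; lra.
Qed.

Lemma has_deriv_cst a b (v : 'cV[R]_m) :
  has_deriv p a b (fun=> v) (fun=> 0).
Proof.
move=> c _ e e0; exists 1 => // r _ _.
by rewrite subrr scaler0 subrr (seminorm0 sp) mulr_ge0 // ltW.
Qed.

Lemma has_derivD a b f f' g g' :
  has_deriv p a b f f' -> has_deriv p a b g g' ->
  has_deriv p a b (fun t => f t + g t) (fun t => f' t + g' t).
Proof.
move=> hf hg c cab e e0.
have e20 : 0 < e / 2 by apply: divr_gt0.
have [d1 d10 hd1] := hf c cab _ e20.
have [d2 d20 hd2] := hg c cab _ e20.
exists (Num.min d1 d2) => [|r rab]; first by rewrite lt_min d10.
rewrite le_min => /andP[rd1 rd2].
have -> : f r + g r - (f c + g c) - (r - c) *: (f' c + g' c) =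
    (f r - f c - (r - c) *: f' c) + (g r - g c - (r - c) *: g' c).
  by apply/matrixP => i k; rewrite !mxE; ring.
rewrite [e in leRHS]splitr mulrDl.
by apply: (seminorm_leD sp); [exact: hd1|exact: hd2].
Qed.

Lemma has_deriv_sum a b n (f f' : nat -> R -> 'cV[R]_m) :
  (forall j, (j < n)%N -> has_deriv p a b (f j) (f' j)) ->
  has_deriv p a b (fun t => \sum_(j < n) f j t) (fun t => \sum_(j < n) f' j t).
Proof.
elim: n => [|n IH] hf.
  by refine (has_deriv_eq _ _ (has_deriv_cst (a := a) (b := b) 0)) => t _; rewrite big_ord0.
have hD := has_derivD (IH (fun j jn => hf j (ltnW jn))) (hf n (ltnSn n)).
by refine (has_deriv_eq _ _ hD) => t _; rewrite big_ord_recr.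
Qed.

Lemma has_deriv_scale a b (v : 'cV[R]_m) :
  has_deriv p a b (fun t => t *: v) (fun=> v).
Proof.
move=> c _ e e0; exists 1 => // r _ _.
by rewrite -scalerBl subrr (seminorm0 sp) mulr_ge0 // ltW.
Qed.

Lemma has_deriv_scale_sqr a b (t0 : R) (v : 'cV[R]_m) :
  has_deriv p a b (fun t => (2^-1 * (t - t0) ^+ 2) *: v)
    (fun t => (t - t0) *: v).
Proof.
move=> c _ e e0; have pv0 := seminorm_ge0 sp v.
exists (e / (p v + 1)) => [|r _]; first by apply: divr_gt0 => //; lra.
rewrite ler_pdivlMr; last by lra.
move=> rd; rewrite scalerA -!scalerBl.
have -> : 2^-1 * (r - t0) ^+ 2 - 2^-1 * (c - t0) ^+ 2 - (r - c) * (c - t0) =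
    2^-1 * (r - c) ^+ 2 by field.
rewrite (seminormZ sp) normrM normrX expr2 -!mulrA.
rewrite ger0_norm; last by rewrite invr_ge0.
have := normr_ge0 (r - c); set z := `|r - c| in rd * => z0.
nra.
Qed.

(* Continuous induction: the set of [t] for which the bound, with [C] enlarged by
   [e], holds on [a, t] contains its supremum and extends beyond it. *)
Lemma mean_value_le a b f f' (C : R) :
  a <= b -> has_deriv p a b f f' ->
  (forall t, a <= t <= b -> p (f' t) <= C) ->
  p (f b - f a) <= C * (b - a).
Proof.
move=> ab hf f'C; apply/ler_addgt0Pr => e0 e00.
(* The added 1 covers the case [a = b]. *)
pose e := e0 / (b - a + 1).
have e_gt0 : 0 < e by apply: divr_gt0 => //; lra.
have eE : e * (b - a + 1) = e0 by rewrite divfK // gt_eqF //; lra.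
pose D := C + e.
suff : p (f b - f a) <= D * (b - a) by rewrite /D; nra.
have C0 : 0 <= C.
  by apply: le_trans (seminorm_ge0 sp (f' a)) (f'C _ _); rewrite lexx.
pose good r := p (f r - f a) <= D * (r - a).
pose S := [set t | a <= t <= b /\ forall r, a <= r <= t -> good r].
have Sa : S a.
  split; first by rewrite lexx.
  move=> r /andP[ar ra]; have -> : r = a by lra.
  by rewrite /good !subrr (seminorm0 sp) mulr0.
have Sub : has_ubound S by exists b => t [/andP[]].
set c := sup S.
have ac : a <= c by exact: ub_le_sup.
have cb : c <= b by apply: ge_sup => [|t [/andP[]] //]; exists a.
have cab : a <= c <= b by rewrite ac.
have [d d0 hd] := hf c cab e e_gt0.
have near_c r : a <= r <= b -> `|r - c| <= d -> p (f r - f c) <= D * `|r - c|.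
  move=> rab rd; rewrite -[f r - f c](subrK ((r - c) *: f' c)).
  rewrite /D addrC mulrDl addrC [X in _ <= X]addrC.
  apply: (seminorm_leD sp); first exact: hd.
  by rewrite (seminormZ sp) mulrC ler_wpM2r // f'C.
have below r : a <= r -> r < c -> good r.
  move=> ar rc; have [|t [_ St] rt] := sup_gt _ rc; first by exists a.
  by apply: St; rewrite ar ltW.
have goodc : good c.
  have [ca|ac'] := leP c a.
    have -> : c = a by lra.
    by rewrite /good !subrr (seminorm0 sp) mulr0.
  (* [r] is strictly below [c], where the bound is known, and close enough for [near_c] to carry it
     over to [c]. *)
  pose r := Num.max a (c - d).
  have ar : a <= r by rewrite le_max lexx.
  have rc : r < c by rewrite gt_max ac'; lra.
  have rd : c - d <= r by rewrite le_max lexx orbT.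
  have gr := below r ar rc; rewrite /good in gr *.
  have gc : p (f c - f r) <= D * (c - r).
    rewrite -[f c - f r]opprB (seminormN sp) -[c - r]gtr0_norm; last by lra.
    rewrite distrC; apply: near_c; first by rewrite ar; lra.
    by rewrite ltr0_norm; lra.
  have -> : f c - f a = (f c - f r) + (f r - f a) by rewrite addrA subrK.
  apply: le_trans (seminorm_leD sp gc gr) _; lra.
(* If [c < b], this element of [S] would exceed the supremum [c]. *)
pose t := Num.min b (c + d).
have tb : t <= b by rewrite ge_min lexx.
have td : t <= c + d by rewrite ge_min lexx orbT.
have ct : c <= t by rewrite le_min cb; lra.
have St : S t.
  split; first by apply/andP; split; lra.
  move=> r /andP[ar rt]; have [rc|cr|->//] := ltgtP r c; first exact: below.
  have gr : p (f r - f c) <= D * (r - c).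
    rewrite -[r - c in leRHS]gtr0_norm; last by lra.
    apply: near_c; first by rewrite ar; lra.
    by rewrite gtr0_norm; lra.
  rewrite /good; have -> : f r - f a = (f r - f c) + (f c - f a).
    by rewrite addrA subrK.
  apply: le_trans (seminorm_leD sp gr goodc) _; lra.
have tc : t <= c by exact: ub_le_sup.
suff -> : b = c by [].
move: tc; rewrite /t ge_min => /orP[|]; lra.
Qed.

(** The function [f t - t *: f' a] has derivative [f' t - f' a], itself bounded by the mean value
    inequality. Using it twice in place of integration gives [C] rather than [C / 2]. *)
Lemma taylor2_le a b f f' f'' (C : R) :
  a <= b -> has_deriv p a b f f' -> has_deriv p a b f' f'' ->
  (forall t, a <= t <= b -> p (f'' t) <= C) ->
  p (f b - f a - (b - a) *: f' a) <= C * (b - a) ^+ 2.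
Proof.
move=> ab hf hf' f''C.
have C0 : 0 <= C.
  by apply: le_trans (seminorm_ge0 sp (f'' a)) (f''C _ _); rewrite lexx.
have hg := has_derivD hf (has_deriv_scale (a := a) (b := b) (- f' a)).
suff /(mean_value_le ab hg) : forall t, a <= t <= b ->
    p (f' t - f' a) <= C * (b - a).
  rewrite -mulrA -expr2; congr (p _ <= _).
  by apply/matrixP => i k; rewrite !mxE; ring.
move=> t /andP[at_ tb].
  apply: (@le_trans _ _ (C * (t - a))); last by rewrite ler_wpM2l //; lra.
  apply: mean_value_le at_ (has_deriv_sub (lexx a) tb hf') _.
  by move=> r /andP[ar rt]; apply: f''C; rewrite ar; lra.
Qed.

(** Subtracting the quadratic Taylor polynomial leaves a function whose derivative is the remainder
    of [f'] bounded by [taylor2_le]. *)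
Lemma taylor3_le a b f f' f'' f''' (C : R) :
  a <= b -> has_deriv p a b f f' -> has_deriv p a b f' f'' ->
  has_deriv p a b f'' f''' ->
  (forall t, a <= t <= b -> p (f''' t) <= C) ->
  p (f b - f a - (b - a) *: f' a - (2^-1 * (b - a) ^+ 2) *: f'' a) <=
    C * (b - a) ^+ 3.
Proof.
move=> ab hf hf' hf'' f'''C.
have C0 : 0 <= C.
  by apply: le_trans (seminorm_ge0 sp (f''' a)) (f'''C _ _); rewrite lexx.
have hg := has_derivD (has_derivD hf (has_deriv_scale (a := a) (b := b) (- f' a)))
  (has_deriv_scale_sqr (a := a) (b := b) a (- f'' a)).
suff /(mean_value_le ab hg) : forall t, a <= t <= b ->
    p (f' t - f' a + (t - a) *: - f'' a) <= C * (b - a) ^+ 2.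
  rewrite -mulrA -exprSr; congr (p _ <= _).
  by apply/matrixP => i k; rewrite !mxE; ring.
move=> t /andP[at_ tb].
  apply: (@le_trans _ _ (C * (t - a) ^+ 2)); last first.
    by rewrite ler_wpM2l // lerXn2r ?nnegrE; lra.
  rewrite scalerN; apply: taylor2_le at_ (has_deriv_sub (lexx a) tb hf')
    (has_deriv_sub (lexx a) tb hf'') _.
  by move=> r /andP[ar rt]; apply: f'''C; rewrite ar; lra.
Qed.

End HasDeriv.

(** * One-sided derivatives on [0, T]: limits of difference quotients versus [has_deriv] *)

Section DerivOn.
Variables (R : realType) (m : nat) (T : R).
Implicit Types (f g : R -> 'cV[R]_m).

Lemma within_itv_dnbhsP (t : R) (Q : set R) :
  (within `[0, T] t^') Q <->
  exists2 d : R, 0 < d & forall r, 0 <= r <= T -> r != t -> `|r - t| <= d -> Q r.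
Proof.
split=> [/nbhs_ballP[d /= d0 dQ]|[d d0 dQ]].
  exists (d / 2) => [|r rT rt rd]; first by apply: divr_gt0.
  apply: (dQ r) => //=.
  by rewrite /ball /= distrC; apply: le_lt_trans rd _; lra.
apply/nbhs_ballP; exists d => //= r; rewrite /ball /= distrC => rd rt.
by rewrite in_itv /= => rT; apply: dQ => //; exact: ltW.
Qed.

(** As [T > 0], each point of [0, T] is an accumulation point of it; this makes the limit in
    [deriv_on] unique. *)
Lemma within_itv_dnbhs_proper (t : R) :
  0 < T -> 0 <= t <= T -> ProperFilter (within `[0, T] t^').
Proof.
move=> T0 /andP[t0 tT]; split; last exact: within_filter.
move=> /within_itv_dnbhsP[d d0 dP]; have [tT'|Tt] := ltP t T.
  pose r := Num.min T (t + d).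
  have rT : r <= T by rewrite ge_min lexx.
  have rd : r <= t + d by rewrite ge_min lexx orbT.
  have tr : t < r by rewrite lt_min tT'; lra.
  apply: (dP r); first by apply/andP; split; lra.
    by rewrite gt_eqF.
  by rewrite gtr0_norm; lra.
pose r := Num.max 0 (t - d).
have r0 : 0 <= r by rewrite le_max lexx.
have rd : t - d <= r by rewrite le_max lexx orbT.
have rt : r < t by rewrite gt_max; apply/andP; split; lra.
apply: (dP r); first by apply/andP; split; lra.
  by rewrite lt_eqF.
by rewrite ltr0_norm; lra.
Qed.

Lemma diff_quot_subE f (v : 'cV[R]_m) (t r : R) : r != t ->
  f r - f t - (r - t) *: v = (r - t) *: (diff_quot f t r - v).
Proof.
by move=> rt; rewrite /diff_quot scalerBr scalerA mulfV ?scale1r // subr_eq0.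
Qed.

Lemma derivable_has_deriv (p : 'cV[R]_m -> R) f :
  is_seminorm p -> derivable_on T f -> has_deriv p 0 T f (deriv_on T f).
Proof.
move=> sp hf c cT e e0; have [k k0 kP] := seminorm_le_coord sp.
have ek : 0 < e / (k + 1) by apply: divr_gt0 => //; lra.
have /cvgrPdist_le/(_ _ ek)/within_itv_dnbhsP[d d0 dP] := hf c cT.
exists d => // r rT rd; have [->|rc] := eqVneq r c.
  by rewrite !subrr scale0r subrr (seminorm0 sp) normr0 mulr0.
rewrite diff_quot_subE // (seminormZ sp) mulrC ler_wpM2r //.
apply: (@le_trans _ _ (k * (e / (k + 1)))); last first.
  rewrite mulrA ler_pdivrMr; last by lra.
  by rewrite mulrC ler_wpM2l ?ltW //; lra.
apply: kP => i; apply: le_trans (ler_mx_norm_coord _ _ _) _.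
by rewrite distrC; exact: dP.
Qed.

(** Uniqueness of limits; this serves to compute the higher derivatives of [u] from those of the
    [phi u j]. *)
Lemma deriv_onE f g (t : R) : 0 < T ->
  has_deriv (fun x => `|x|) 0 T f g -> 0 <= t <= T -> deriv_on T f t = g t.
Proof.
move=> T0 hf tT; have := within_itv_dnbhs_proper T0 tT => pF.
apply: cvg_lim; first exact: norm_hausdorff.
apply/cvgrPdist_le => e e0; apply/within_itv_dnbhsP.
have [d d0 dP] := hf t tT e e0; exists d => // r rT rt rd.
have := dP r rT rd; rewrite diff_quot_subE // normrZ mulrC distrC.
by rewrite ler_pM2r // normr_gt0 subr_eq0.
Qed.

Lemma mx_norm_seminorm : is_seminorm (fun x : 'cV[R]_m => `|x|).
Proof. by split=> [a x|x y]; [exact: normrZ|exact: ler_normD]. Qed.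

End DerivOn.

(** * Error recursion *)

(* Summation by parts: [e k - xi k.-1] satisfies a recursion whose forcing terms
   are [eta k] and the increments of [xi], so [xi] need not be summed over [k]. *)
Lemma power_bounded_recursion (R : realType) (m : nat) (p : 'cV[R]_m -> R)
    (B : 'M[R]_m) (e xi eta : nat -> 'cV[R]_m) (n : nat) (K X Y H : R) :
  is_seminorm p ->
  (forall j x, p (B ^+ j *m x) <= K * p x) ->
  e 0%N = 0 ->
  (forall k, (k < n)%N -> e k.+1 = B *m e k + (xi k - B *m xi k) + eta k) ->
  0 <= K -> 0 <= X -> 0 <= H ->
  (forall k, (k < n)%N -> p (xi k) <= X) ->
  (forall k, (k < n)%N -> p (xi k - xi k.-1) <= Y) ->
  (forall k, (k < n)%N -> p (eta k) <= H) ->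
  p (e n) <= X + (K * X + n%:R * (K * (H + K * Y))).
Proof.
move=> sp BK e0 eS K0 X0 H0 xiX xiY etaH.
case: n => [|n] in eS xiX xiY etaH *.
  by rewrite e0 (seminorm0 sp) mul0r addr0 addr_ge0 // mulr_ge0.
(* [0.-1] is [0], so [f 0] is [- xi 0] and the first increment of [xi] vanishes. *)
pose f k := e k - xi k.-1.
have fS k : (k < n.+1)%N -> f k.+1 = B *m f k + (eta k - B *m (xi k - xi k.-1)).
  move=> kn; rewrite /f /= eS // !mulmxBr.
  by apply/matrixP => i j; rewrite !mxE; ring.
(* All powers of [B] are treated together: bounding [B *m f k] by [K * p (f k)] at each step would
   accumulate powers of [K]. *)
have fP k : (k <= n.+1)%N -> forall j,
    p (B ^+ j *m f k) <= K * X + k%:R * (K * (H + K * Y)).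
  elim: k => [_|k IH kn] j.
    rewrite /f e0 /= sub0r mul0r addr0; apply: le_trans (BK _ _) _.
    by rewrite (seminormN sp) ler_wpM2l // xiX.
  rewrite fS // mulmxDr mulmxA -[B ^+ j *m B]/(B ^+ j * B) -exprSr.
  rewrite -natr1 mulrDl mul1r addrA.
  apply: (seminorm_leD sp); first exact: (IH (ltnW kn)).
  apply: le_trans (BK _ _) _; rewrite ler_wpM2l //.
  apply: (seminorm_leB sp); first exact: etaH.
  by apply: le_trans (BK 1%N _) _; rewrite ler_wpM2l // xiY.
have -> : e n.+1 = xi n + f n.+1 by rewrite /f /= subrKC.
apply: (seminorm_leD sp); first exact: xiX.
by have := fP n.+1 (leqnn _) 0%N; rewrite expr0 mul1mx.
Qed.

Lemma big_mulmx_rcons (R : pzRingType) (m : nat) (I : Type) (r : seq I) (x : I)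
    (F : I -> 'M[R]_m) :
  \big[mulmx/1%:M]_(i <- rcons r x) F i =
  (\big[mulmx/1%:M]_(i <- r) F i) *m F x.
Proof.
elim: r => [|y r IH] /=; first by rewrite big_cons big_nil mul1mx mulmx1.
by rewrite !big_cons IH mulmxA.
Qed.

(** * The error after one step of the method *)

Section OneStep.
Variables (R : realType) (s : nat) (P : linear_ivp R) (dt : R).
Local Notation V := 'cV[R]_(ivp_dim P).
Implicit Types (u : R -> V).

Definition Qprod (k : nat) : 'M[R]_(ivp_dim P) :=
  \big[mulmx/1%:M]_(i <- iota 1 k) Qmx P dt i.

Definition Qinvprod (k : nat) : 'M[R]_(ivp_dim P) :=
  \big[mulmx/1%:M]_(j <- rev (iota 1 k)) invmx (Qmx P dt j).

Lemma iota1S k : iota 1 k.+1 = rcons (iota 1 k) k.+1.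
Proof. by rewrite -[in LHS](addn1 k) iotaD add1n cats1. Qed.

Lemma QprodS k : Qprod k.+1 = Qprod k *m Qmx P dt k.+1.
Proof. by rewrite /Qprod iota1S big_mulmx_rcons. Qed.

Lemma QinvprodS k : Qinvprod k.+1 = invmx (Qmx P dt k.+1) *m Qinvprod k.
Proof. by rewrite /Qinvprod iota1S rev_rcons big_cons. Qed.

Hypothesis Qu : forall j, (1 <= j <= s)%N -> Qmx P dt j \in unitmx.

Lemma QinvprodK k : (k <= s)%N -> Qinvprod k *m Qprod k = 1%:M.
Proof.
elim: k => [_|k IH ks]; first by rewrite /Qinvprod /Qprod !big_nil mul1mx.
rewrite QinvprodS QprodS -mulmxA [Qinvprod k *m _]mulmxA IH ?(ltnW ks) //.
by rewrite mul1mx mulVmx // Qu.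
Qed.

(* The residuals [rho_*] and [rho_j] left when every stage [v_*], [v_j] of the
   method is replaced by the exact value [u b]. *)
Definition res_star u (a b : R) : V := u b - u a - dt *: Ftotal s a (u a).

Definition res_stage u (a b : R) (j : nat) : V :=
  - ((2^-1 * dt) *: (phi u j b - phi u j a)).

(** Each stage is compared with the same relation for [u b]. The residual of stage [j.+1] does not
    pass through the first [j] inverses, hence its factor [Qprod j] under the common
    [Qinvprod s]. *)
Lemma douglas_step_error u (a b : R) (w w' : V) :
  douglas_step s dt a b w w' ->
  u b - w' = Rmx s P dt *m (u a - w) +
    Qinvprod s *m (P0mx P dt *m res_star u a b + res_stage u a b 0 +
      \sum_(j < s) Qprod j *m res_stage u a b j.+1).
Proof.
move=> [vs [v [vsE v0E vE ->]]].
set e := u a - w; set rs := res_star u a b; set r := res_stage u a b.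
have vsE' : u b - vs = e + Zmx s P dt *m e + rs.
  rewrite vsE /rs /res_star /Zmx -scalemxAl.
  have -> : Atotal s P *m e = Ftotal s a (u a) - Ftotal s a w.
    rewrite /Atotal /Ftotal -sumrB mulmx_suml; apply: eq_bigr => j _.
    by rewrite /Fj mulmxBr; apply/matrixP => i k; rewrite !mxE; ring.
  by apply/matrixP => i k; rewrite !mxE; ring.
have v0E' : u b - v 0%N - e = P0mx P dt *m (Zmx s P dt *m e + rs) + r 0%N.
  have -> : Zmx s P dt *m e + rs = u b - vs - e.
    by rewrite vsE'; apply/matrixP => i k; rewrite !mxE; ring.
  rewrite v0E /r /res_stage /phi /Fj /P0mx mulmxDl mul1mx -scalemxAl.
  rewrite /e !mulmxBr.
  by apply/matrixP => i k; rewrite !mxE; ring.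
(* Subtracting [e] makes the stages recursive: with [x k = u b - v k - e], stage [k.+1] says that
   [Qmx P dt k.+1] maps [x k.+1] to [x k + r k.+1]. *)
suff vkE k : (k <= s)%N -> u b - v k - e = Qinvprod k *m
    (P0mx P dt *m (Zmx s P dt *m e + rs) + r 0%N +
      \sum_(j < k) Qprod j *m r j.+1).
  rewrite -[LHS](subrK e) vkE //.
  have -> : Rmx s P dt *m e = e + Qinvprod s *m (P0mx P dt *m (Zmx s P dt *m e)).
    by rewrite /Rmx -/(Qinvprod s) mulmxDl mul1mx !mulmxA.
  rewrite [LHS]addrC -[RHS]addrA; congr (_ + _); rewrite -mulmxDr; congr (_ *m _).
  by rewrite mulmxDr !addrA.
elim: k => [_|k IH ks].
  by rewrite big_ord0 addr0 /Qinvprod big_nil mul1mx.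
have kQ : Qmx P dt k.+1 \in unitmx by apply: Qu.
have QvE : Qmx P dt k.+1 *m (u b - v k.+1 - e) = (u b - v k - e) + r k.+1.
  rewrite {1}/Qmx mulmxBl mul1mx -scalemxAl {1}vE //=.
  rewrite /r /res_stage /phi /Fj /e !mulmxBr.
  by apply/matrixP => i j; rewrite !mxE; ring.
rewrite -[LHS](mulKmx kQ) QvE IH ?(ltnW ks) // QinvprodS -mulmxA.
congr (_ *m _); rewrite big_ord_recr /=.
set X := _ + r 0%N; rewrite [X + (_ + _)]addrA [RHS]mulmxDr; congr (_ + _).
by rewrite mulmxA QinvprodK ?mul1mx // ltnW.
Qed.

(* [Zmx *m defect] is the part of the residual that is only of second order;
   [defect] itself is [O(dt^2)] by conditions (d) and (e). *)
Definition Qdefect (j : nat) : 'M[R]_(ivp_dim P) :=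
  dt^-1 *: (invmx (Atotal s P) *m (Qprod j - 1%:M)).

Definition defect u (a b : R) : V :=
  2^-1 *: (invmx (Atotal s P) *m coef P 0 *m res_star u a b) +
  \sum_(j < s) Qdefect j *m res_stage u a b j.+1.

(** [Zmx] times the inverse of [Atotal] is the scalar [dt], so [Zmx] turns [Qdefect j] into
    [Qprod j - 1]. What remains carries every residual with weight one. *)
Lemma residual_splitting u (a b : R) :
  dt != 0 -> Atotal s P \in unitmx ->
  P0mx P dt *m res_star u a b + res_stage u a b 0 +
    \sum_(j < s) Qprod j *m res_stage u a b j.+1 =
  (res_star u a b + \sum_(j < s.+1) res_stage u a b j) +
    Zmx s P dt *m defect u a b.
Proof.
move=> dt0 Au; set rs := res_star u a b; set r := res_stage u a b.
rewrite /P0mx mulmxDl mul1mx /defect -/rs -/r.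
rewrite [Zmx s P dt *m _]mulmxDr.
have -> : Zmx s P dt *m (2^-1 *: (invmx (Atotal s P) *m coef P 0 *m rs)) =
    (2^-1 * dt) *: coef P 0 *m rs.
  rewrite /Zmx -scalemxAr -!scalemxAl scalerA mulmxA mulmxA mulmxV //.
  by rewrite mul1mx.
have -> : Zmx s P dt *m (\sum_(j < s) Qdefect j *m r j.+1) =
    \sum_(j < s) Qprod j *m r j.+1 - \sum_(j < s) r j.+1.
  rewrite mulmx_sumr -sumrB; apply: eq_bigr => j _.
  rewrite /Zmx /Qdefect -!scalemxAl -scalemxAr scalerA mulfV // scale1r.
  by rewrite mulmxA mulmxA mulmxV // mul1mx mulmxBl mul1mx.
rewrite [\sum_(j < s.+1) _]big_ord_recl.
set S1 := \sum_(j < s) _; set S2 := \sum_(j < s) _; set S3 := _ *m rs.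
by apply/matrixP => i j; rewrite !mxE; ring.
Qed.

(** The stage residuals add up because the [phi u j] sum to [Ftotal]; the result is the defect of
    the trapezoidal rule. *)
Lemma trapezoidal_residual u (a b : R) :
  res_star u a b + \sum_(j < s.+1) res_stage u a b j =
  u b - u a - dt *: Ftotal s a (u a) -
    (2^-1 * dt) *: (Ftotal s b (u b) - Ftotal s a (u a)).
Proof.
congr (_ + _); rewrite /res_stage sumrN -scaler_sumr; congr (- (_ *: _)).
by rewrite sumrB.
Qed.

End OneStep.

(** * Estimates for one problem *)

Section FiniteDifferences.
Variables (R : realType) (m : nat) (p : 'cV[R]_m -> R) (T dt C : R).
Variables (f f' f'' f''' : R -> 'cV[R]_m).
Hypothesis sp : is_seminorm p.
Hypothesis dt0 : 0 <= dt.
Hypotheses (df : has_deriv p 0 T f f') (df' : has_deriv p 0 T f' f'').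

Lemma increment_le (a b : R) :
  (forall t, 0 <= t <= T -> p (f' t) <= C) ->
  0 <= a -> b <= T -> b - a = dt -> p (f b - f a) <= C * dt.
Proof.
move=> fC a0 bT ba; have ab : a <= b by have := dt0; lra.
rewrite -ba; apply: (mean_value_le (f' := f') sp) => //.
  exact: has_deriv_sub df.
by move=> t /andP[at_ tb]; apply: fC; apply/andP; split; lra.
Qed.

Section Order2.
Hypothesis f2C : forall t, 0 <= t <= T -> p (f'' t) <= C.

Lemma remainder2_le (a b : R) :
  0 <= a -> b <= T -> b - a = dt ->
  p (f b - f a - dt *: f' a) <= C * dt ^+ 2.
Proof.
move=> a0 bT ba; have ab : a <= b by have := dt0; lra.
rewrite -ba; apply: (taylor2_le (f'' := f'') sp) => //.
- exact: has_deriv_sub df.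
- exact: has_deriv_sub df'.
- by move=> t /andP[at_ tb]; apply: f2C; apply/andP; split; lra.
Qed.

End Order2.

Hypothesis df'' : has_deriv p 0 T f'' f'''.
Hypothesis f3C : forall t, 0 <= t <= T -> p (f''' t) <= C.

Lemma remainder3_le (a b : R) :
  0 <= a -> b <= T -> b - a = dt ->
  p (f b - f a - dt *: f' a - (2^-1 * dt ^+ 2) *: f'' a) <= C * dt ^+ 3.
Proof.
move=> a0 bT ba; have ab : a <= b by have := dt0; lra.
rewrite -ba; apply: (taylor3_le (f''' := f''') sp) => //.
- exact: has_deriv_sub df.
- exact: has_deriv_sub df'.
- exact: has_deriv_sub df''.
- by move=> t /andP[at_ tb]; apply: f3C; apply/andP; split; lra.
Qed.

End FiniteDifferences.

Section FiniteDifferencesOfRemainders.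
Variables (R : realType) (m : nat) (p : 'cV[R]_m -> R) (T dt C : R).
Variables (f f' f'' f''' : R -> 'cV[R]_m).
Hypothesis sp : is_seminorm p.
Hypothesis dt0 : 0 <= dt.
Hypotheses (df : has_deriv p 0 T f f') (df' : has_deriv p 0 T f' f'').

(** Each increment is [dt *: f'] at its left end up to [C * dt ^+ 2], and [f'] changes by at most
    [C * dt]: three terms. Differencing gains the order needed for the increments of [xi]. *)
Lemma increment_diff_le (a b c : R) :
  (forall t, 0 <= t <= T -> p (f'' t) <= C) ->
  0 <= a -> c <= T -> b - a = dt -> c - b = dt ->
  p ((f c - f b) - (f b - f a)) <= 3 * C * dt ^+ 2.
Proof.
move=> f2C a0 cT ba cb; have d0 := dt0.
have r1 : p (f b - f a - dt *: f' a) <= C * dt ^+ 2.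
  by apply: (remainder2_le sp dt0 df df') => //; lra.
have r2 : p (f c - f b - dt *: f' b) <= C * dt ^+ 2.
  by apply: (remainder2_le sp dt0 df df') => //; lra.
have r3 : p (dt *: (f' b - f' a)) <= dt * (C * dt).
  rewrite (seminormZ sp) ger0_norm // ler_wpM2l //.
  by apply: (increment_le sp dt0 df') => //; lra.
have -> : f c - f b - (f b - f a) = (f c - f b - dt *: f' b) -
    (f b - f a - dt *: f' a) + dt *: (f' b - f' a).
  by apply/matrixP => i j; rewrite !mxE; ring.
have -> : 3 * C * dt ^+ 2 = C * dt ^+ 2 + C * dt ^+ 2 + dt * (C * dt) by ring.
by apply: (seminorm_leD sp) r3; apply: (seminorm_leB sp).
Qed.

Hypothesis df'' : has_deriv p 0 T f'' f'''.
Hypothesis f3C : forall t, 0 <= t <= T -> p (f''' t) <= C.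

(** The same scheme one order higher, with leading term [(2^-1 * dt ^+ 2) *: f'']. *)
Lemma remainder2_diff_le (a b c : R) :
  0 <= a -> c <= T -> b - a = dt -> c - b = dt ->
  p ((f c - f b - dt *: f' b) - (f b - f a - dt *: f' a)) <= 3 * C * dt ^+ 3.
Proof.
move=> a0 cT ba cb; have d0 := dt0.
have r1 : p (f b - f a - dt *: f' a - (2^-1 * dt ^+ 2) *: f'' a) <= C * dt ^+ 3.
  by apply: (remainder3_le sp dt0 df df' df'' f3C) => //; lra.
have r2 : p (f c - f b - dt *: f' b - (2^-1 * dt ^+ 2) *: f'' b) <= C * dt ^+ 3.
  by apply: (remainder3_le sp dt0 df df' df'' f3C) => //; lra.
have i0 : p (f'' b - f'' a) <= C * dt.
  by apply: (increment_le sp dt0 df'' f3C) => //; lra.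
have d2 : 0 <= 2^-1 * dt ^+ 2 by rewrite mulr_ge0 ?invr_ge0 ?exprn_ge0.
have r3 : p ((2^-1 * dt ^+ 2) *: (f'' b - f'' a)) <= C * dt ^+ 3.
  rewrite (seminormZ sp) ger0_norm //.
  apply: le_trans (ler_wpM2l d2 i0) _.
  have := le_trans (seminorm_ge0 sp _) r1; lra.
rewrite [X in p X](_ : _ =
    (f c - f b - dt *: f' b - (2^-1 * dt ^+ 2) *: f'' b) -
    (f b - f a - dt *: f' a - (2^-1 * dt ^+ 2) *: f'' a) +
    (2^-1 * dt ^+ 2) *: (f'' b - f'' a)); last first.
  by apply/matrixP => i j; rewrite !mxE; ring.
have -> : 3 * C * dt ^+ 3 = C * dt ^+ 3 + C * dt ^+ 3 + C * dt ^+ 3 by ring.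
by apply: (seminorm_leD sp) r3; apply: (seminorm_leB sp).
Qed.

(** The Taylor remainders of [f] and [f'] are combined so that the terms in [f'' a] cancel. *)
Lemma trapezoidal_rule_le (a b : R) :
  0 <= a -> b <= T -> b - a = dt ->
  p (f b - f a - dt *: f' a - (2^-1 * dt) *: (f' b - f' a)) <= 2 * C * dt ^+ 3.
Proof.
move=> a0 bT ba.
have r1 : p (f b - f a - dt *: f' a - (2^-1 * dt ^+ 2) *: f'' a) <= C * dt ^+ 3.
  exact: (remainder3_le sp dt0 df df' df'' f3C).
have i0 : p (f' b - f' a - dt *: f'' a) <= C * dt ^+ 2.
  exact: (remainder2_le sp dt0 df' df'' f3C).
have d2 : 0 <= 2^-1 * dt by rewrite mulr_ge0 ?invr_ge0.
have r2 : p ((2^-1 * dt) *: (f' b - f' a - dt *: f'' a)) <= C * dt ^+ 3.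
  rewrite (seminormZ sp) ger0_norm //.
  apply: le_trans (ler_wpM2l d2 i0) _.
  have := le_trans (seminorm_ge0 sp _) r1; lra.
rewrite [X in p X](_ : _ =
    (f b - f a - dt *: f' a - (2^-1 * dt ^+ 2) *: f'' a) -
    (2^-1 * dt) *: (f' b - f' a - dt *: f'' a)); last first.
  by apply/matrixP => i j; rewrite !mxE; ring.
have -> : 2 * C * dt ^+ 3 = C * dt ^+ 3 + C * dt ^+ 3 by ring.
exact: (seminorm_leB sp).
Qed.

End FiniteDifferencesOfRemainders.

(** * Inverting a perturbation of the identity *)

Section PerturbedIdentity.
Variables (R : realType) (m : nat) (N : 'cV[R]_m -> R) (B : 'M[R]_m) (l : R).
Hypotheses (nN : is_norm N) (l1 : l < 1).
Hypothesis Bl : forall x, N (B *m x) <= l * N x.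
Let sN := is_norm_seminorm nN.

Lemma perturbed_identity_ge x : (1 - l) * N x <= N ((1%:M + B) *m x).
Proof.
have := seminorm_leB sN (lexx (N ((1%:M + B) *m x))) (Bl x).
by rewrite mulmxDl mul1mx addrK; lra.
Qed.

(** [perturbed_identity_ge] makes the kernel trivial; [det0P] speaks of row vectors, hence the
    transposes. *)
Lemma perturbed_identity_unitmx : 1%:M + B \in unitmx.
Proof.
rewrite unitmxE unitfE -det_tr; apply/det0P => -[v v0 vB].
have Bv : (1%:M + B) *m v^T = 0 by rewrite -[RHS]trmx0 -vB trmx_mul trmxK.
have := perturbed_identity_ge v^T; rewrite Bv (seminorm0 sN).
have l1' : 0 < 1 - l by rewrite subr_gt0.
rewrite pmulr_rle0 // => Nv.
have [N0 _ _] := nN.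
have /N0 vT0 : N v^T = 0 by apply/le_anti; rewrite Nv (seminorm_ge0 sN).
by move: v0; rewrite -[v]trmxK vT0 trmx0 eqxx.
Qed.

Lemma perturbed_identity_inv_le y :
  N (invmx (1%:M + B) *m y) <= (1 - l)^-1 * N y.
Proof.
have l1' : 0 < 1 - l by rewrite subr_gt0.
rewrite ler_pdivlMl //.
by apply: le_trans (perturbed_identity_ge _) _;
   rewrite mulKVmx // perturbed_identity_unitmx.
Qed.

End PerturbedIdentity.

(** * Derivatives of the exact solution *)

Section ExactSolution.
Variables (R : realType) (s : nat) (T : R) (P : linear_ivp R).
Variable u : R -> 'cV[R]_(ivp_dim P).
Hypothesis T0 : 0 < T.
Hypothesis hu : exact_solution s T u.
Hypothesis hphi : forall j, (j <= s)%N -> twice_cont_diff_on T (phi u j).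

Let u1 t := Ftotal s t (u t).
Let u2 t := \sum_(j < s.+1) deriv_on T (phi u j) t.
Let u3 t := \sum_(j < s.+1) deriv_on T (deriv_on T (phi u j)) t.

Lemma phi_has_deriv (p : 'cV[R]_(ivp_dim P) -> R) j :
  is_seminorm p -> (j <= s)%N ->
  has_deriv p 0 T (phi u j) (deriv_on T (phi u j)) /\
  has_deriv p 0 T (deriv_on T (phi u j)) (deriv_on T (deriv_on T (phi u j))).
Proof.
move=> sp js; have [d1 d2 _] := hphi js.
by split; apply: derivable_has_deriv.
Qed.

Lemma exact_has_deriv (p : 'cV[R]_(ivp_dim P) -> R) : is_seminorm p ->
  [/\ has_deriv p 0 T u u1, has_deriv p 0 T u1 u2 & has_deriv p 0 T u2 u3].
Proof.
move=> sp; have [_ du uE] := hu; split.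
- by refine (has_deriv_eq _ _ (derivable_has_deriv sp du)).
- refine (has_deriv_sum sp (f := phi u)
    (f' := fun j => deriv_on T (phi u j)) _) => j js.
  by have [] := phi_has_deriv sp js.
- refine (has_deriv_sum sp (f := fun j => deriv_on T (phi u j))
    (f' := fun j => deriv_on T (deriv_on T (phi u j))) _) => j js.
  by have [] := phi_has_deriv sp js.
Qed.

(** Condition (d) speaks of iterated [deriv_on] of [u], the estimates of sums of derivatives of the
    [phi u j]; this lemma and [exact_deriv3E] translate. *)
Lemma exact_deriv2E t : 0 <= t <= T -> deriv_on T (deriv_on T u) t = u2 t.
Proof.
have [_ _ uE] := hu.
have [_ d2 _] := exact_has_deriv (@mx_norm_seminorm R (ivp_dim P)).
apply: deriv_onE T0 _; refine (has_deriv_eq _ _ d2) => // r rT.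
by rewrite uE.
Qed.

Lemma exact_deriv3E t :
  0 <= t <= T -> deriv_on T (deriv_on T (deriv_on T u)) t = u3 t.
Proof.
have [_ _ d3] := exact_has_deriv (@mx_norm_seminorm R (ivp_dim P)).
apply: deriv_onE T0 _; refine (has_deriv_eq _ _ d3) => // r rT.
by rewrite exact_deriv2E.
Qed.

End ExactSolution.

Lemma seminorm_sum_le (R : realType) (m : nat) (p : 'cV[R]_m -> R) (n : nat)
    (F : nat -> 'cV[R]_m) (c : R) :
  is_seminorm p -> (forall j, (j < n)%N -> p (F j) <= c) ->
  p (\sum_(j < n) F j) <= n%:R * c.
Proof.
move=> sp Fc; apply: le_trans (seminorm_sum sp _ _) _.
apply: (@le_trans _ _ (\sum_(j < n) c)).
  by apply: ler_sum => j _; exact: Fc.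
by rewrite sumr_const card_ord mulr_natl.
Qed.

(** * The error bound for a fixed mesh-width and step-size *)

Section OneProblem.
Variables (R : realType) (s : nat) (T : R) (P : linear_ivp R) (dt : R).
Variable u : R -> 'cV[R]_(ivp_dim P).
Variables (L M K C : R).
Local Notation V := 'cV[R]_(ivp_dim P).
Local Notation N := (@vnorm R P).
Hypothesis dt_gt0 : 0 < dt.
Hypothesis hu : exact_solution s T u.
Hypothesis hphi : forall j, (j <= s)%N -> twice_cont_diff_on T (phi u j).
Hypothesis C_ge0 : 0 <= C.

Let sN : is_seminorm N := is_norm_seminorm (vnormP P).
Let dt_ge0 : 0 <= dt := ltW dt_gt0.
Let G := invmx (Atotal s P) *m coef P 0.
Let u2 t := \sum_(j < s.+1) deriv_on T (phi u j) t.
Let u3 t := \sum_(j < s.+1) deriv_on T (deriv_on T (phi u j)) t.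

Hypothesis phi2C : forall j t, (j <= s)%N -> 0 <= t <= T ->
  N (deriv_on T (deriv_on T (phi u j)) t) <= C.
Hypothesis Gu2C : forall t, 0 <= t <= T -> N (G *m u2 t) <= C.
Hypothesis Gu3C : forall t, 0 <= t <= T -> N (G *m u3 t) <= C.
Hypothesis Qphi1C : forall j t, (j < s)%N -> 0 <= t <= T ->
  N (Qdefect s P dt j *m deriv_on T (phi u j.+1) t) <= C.
Hypothesis Qphi2C : forall j t, (j < s)%N -> 0 <= t <= T ->
  N (Qdefect s P dt j *m deriv_on T (deriv_on T (phi u j.+1)) t) <= C.

Lemma norm_half_le (x : V) c : N x <= c -> N (2^-1 *: x) <= c.
Proof.
move=> xc; rewrite (seminormZ sN) ger0_norm; last by rewrite invr_ge0.
have := seminorm_ge0 sN x; lra.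
Qed.

Lemma norm_stage_le (B : 'M[R]_(ivp_dim P)) (x : V) c :
  N (B *m x) <= c -> N (B *m (- ((2^-1 * dt) *: x))) <= c * dt.
Proof.
move=> xc; rewrite mulmxN (seminormN sN) -scalemxAr -scalerA.
apply: norm_half_le; rewrite (seminormZ sN) ger0_norm // mulrC.
by rewrite ler_wpM2r.
Qed.

(** [res_star] is a second-order Taylor remainder of [u], and each of the [s] stage residuals is
    [dt / 2] times an increment of some [phi u j], up to sign: [s.+1] terms in all. *)
Lemma defect_le (a b : R) : 0 <= a -> b <= T -> b - a = dt ->
  N (defect s dt u a b) <= s.+1%:R * C * dt ^+ 2.
Proof.
move=> a0 bT ba; rewrite -natr1 [s%:R + 1]addrC -mulrA mulrDl mul1r.
apply: (seminorm_leD sN).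
  apply: norm_half_le.
  have sG := seminorm_mulmx sN G; have [d1 d2 _] := exact_has_deriv hu hphi sG.
  exact: (remainder2_le sG dt_ge0 d1 d2 Gu2C).
apply: (seminorm_sum_le (F := fun j => Qdefect s P dt j *m
  res_stage dt u a b j.+1) sN) => j js.
have sQ := seminorm_mulmx sN (Qdefect s P dt j).
have [d1 _] := phi_has_deriv hphi sQ js.
rewrite expr2 mulrA; apply: norm_stage_le.
by apply: (increment_le sQ dt_ge0 d1) => // t; exact: Qphi1C.
Qed.

Lemma defect_diff_le (a b c : R) :
  0 <= a -> c <= T -> b - a = dt -> c - b = dt ->
  N (defect s dt u b c - defect s dt u a b) <= s.+1%:R * (3 * C) * dt ^+ 3.
Proof.
move=> a0 cT ba cb; rewrite -natr1 [s%:R + 1]addrC -[leRHS]mulrA mulrDl mul1r.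
rewrite /defect opprD addrACA -scalerBr -mulmxBr -sumrB.
apply: (seminorm_leD sN).
  apply: norm_half_le.
  have sG := seminorm_mulmx sN G; have [d1 d2 d3] := exact_has_deriv hu hphi sG.
  exact: (remainder2_diff_le sG dt_ge0 d1 d2 d3 Gu3C).
apply: (seminorm_sum_le (F := fun j => Qdefect s P dt j *m
  res_stage dt u b c j.+1 - Qdefect s P dt j *m res_stage dt u a b j.+1) sN)
  => j js.
have sQ := seminorm_mulmx sN (Qdefect s P dt j).
have [d1 d2] := phi_has_deriv hphi sQ js.
rewrite -mulmxBr /res_stage -opprD -scalerBr [dt ^+ 3]exprSr mulrA.
apply: norm_stage_le.
by apply: (increment_diff_le sQ dt_ge0 d1 d2) => // t; exact: Qphi2C.
Qed.

Lemma trapezoidal_residual_le (a b : R) : 0 <= a -> b <= T -> b - a = dt ->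
  N (res_star s dt u a b + \sum_(j < s.+1) res_stage dt u a b j) <=
  s.+1%:R * (2 * C) * dt ^+ 3.
Proof.
move=> a0 bT ba; rewrite trapezoidal_residual.
have [d1 d2 d3] := exact_has_deriv hu hphi sN.
rewrite [s.+1%:R * _]mulrCA; apply: (trapezoidal_rule_le sN dt_ge0 d1 d2 d3) => // t tT.
apply: (seminorm_sum_le (F := fun j => deriv_on T (deriv_on T (phi u j)) t) sN).
by move=> j js; apply: phi2C.
Qed.

Hypothesis Au : Atotal s P \in unitmx.
Hypothesis L2 : L < 2.
Hypothesis M_ge0 : 0 <= M.
Hypothesis K_ge0 : 0 <= K.
Hypothesis A0L : forall x : V, N (dt *: coef P 0 *m x) <= L * N x.
Hypothesis Qu : forall j, (1 <= j <= s)%N -> Qmx P dt j \in unitmx.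
Hypothesis QM : forall j (x : V), (1 <= j <= s)%N ->
  N (invmx (Qmx P dt j) *m x) <= M * N x.
Hypothesis RK : forall n (x : V), N (Rmx s P dt ^+ n *m x) <= K * N x.
Hypothesis A0C : forall j, (1 <= j <= s)%N ->
  coef P 0 *m coef P j = coef P j *m coef P 0.

Lemma Qinvprod_le k (x : V) :
  (k <= s)%N -> N (Qinvprod P dt k *m x) <= M ^+ k * N x.
Proof.
elim: k => [_|k IH ks]; first by rewrite /Qinvprod big_nil mul1mx expr0 mul1r.
rewrite QinvprodS -mulmxA; apply: le_trans (QM _ _) _ => //.
by rewrite exprS -mulrA ler_wpM2l // IH // ltnW.
Qed.

Lemma half_dtA0_le (x : V) : N ((2^-1 * dt) *: coef P 0 *m x) <= L / 2 * N x.
Proof.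
rewrite -scalerA -scalemxAl (seminormZ sN) ger0_norm ?invr_ge0 //.
rewrite [L / 2]mulrC -mulrA.
by rewrite ler_wpM2l ?invr_ge0.
Qed.

Let L21 : L / 2 < 1.
Proof. by have := L2; lra. Qed.

Lemma P0mx_unitmx : P0mx P dt \in unitmx.
Proof. exact: (perturbed_identity_unitmx (vnormP P) L21 half_dtA0_le). Qed.

Lemma invmx_P0mx_le (x : V) :
  N (invmx (P0mx P dt) *m x) <= (1 - L / 2)^-1 * N x.
Proof. exact: (perturbed_identity_inv_le (vnormP P) L21 half_dtA0_le). Qed.

(** Condition (c) enters here: [A_0] commutes with every summand of [A], trivially with itself. *)
Lemma P0mx_ZmxC : P0mx P dt *m Zmx s P dt = Zmx s P dt *m P0mx P dt.
Proof.
have A0A : coef P 0 *m Atotal s P = Atotal s P *m coef P 0.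
  rewrite /Atotal mulmx_sumr mulmx_suml; apply: eq_bigr => -[[|j] js] _ //=.
  exact: A0C.
rewrite /P0mx /Zmx mulmxDl mulmxDr mul1mx mulmx1 -!scalemxAl -!scalemxAr A0A.
by rewrite !scalerA [dt * _]mulrC.
Qed.

(** Once [P0mx] is moved past [Zmx], it cancels the inverse in [xi]. The second-order part of the
    local error thus takes the form that summation by parts absorbs. *)
Lemma defect_transfer (y : V) :
  let xi := - (invmx (P0mx P dt) *m y) in
  xi - Rmx s P dt *m xi = Qinvprod P dt s *m (Zmx s P dt *m y).
Proof.
move=> xi; rewrite /xi mulmxN opprK /Rmx -/(Qinvprod P dt s) mulmxDl mul1mx.
rewrite addrA addNr add0r -[Qinvprod P dt s *m _ *m _]mulmxA P0mx_ZmxC -!mulmxA.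
by rewrite mulKVmx // P0mx_unitmx.
Qed.

(** [X], [Y], [H] are the coefficients of [dt ^+ 2], [dt ^+ 3], [dt ^+ 3] in the bounds on [xi], its
    increments and the trapezoidal part [eta]. *)
Definition error_constant : R :=
  let X := (1 - L / 2)^-1 * (s.+1%:R * C) in
  let Y := (1 - L / 2)^-1 * (s.+1%:R * (3 * C)) in
  let H := M ^+ s * (s.+1%:R * (2 * C)) in
  X + K * X + T * (K * (H + K * Y)).

Lemma douglas_error_le (U : nat -> V) (n : nat) :
  douglas_sequence s T dt U -> n%:R * dt <= T ->
  N (u (n%:R * dt) - U n) <= error_constant * dt ^+ 2.
Proof.
move=> [U0 US] nT.
pose t k : R := k%:R * dt.
pose y k := defect s dt u (t k) (t k.+1).
pose xi k := - (invmx (P0mx P dt) *m y k).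
pose eta k := Qinvprod P dt s *m (res_star s dt u (t k) (t k.+1) +
  \sum_(j < s.+1) res_stage dt u (t k) (t k.+1) j).
pose e k := u (t k) - U k.
have t0 k : 0 <= t k by rewrite mulr_ge0.
have tS k : t k.+1 - t k = dt by rewrite /t -natr1; ring.
have tT k : (k <= n)%N -> t k <= T.
  by move=> kn; apply: le_trans nT; rewrite ler_wpM2r // ler_nat.
have l0 : 0 <= (1 - L / 2)^-1 by rewrite invr_ge0 subr_ge0 ltW.
have s0 : 0 <= (s.+1%:R : R) by [].
have [u0 _ _] := hu.
have e0 : e 0%N = 0 by rewrite /e /t mul0r u0 U0 subrr.
have eS k : (k < n)%N ->
    e k.+1 = Rmx s P dt *m e k + (xi k - Rmx s P dt *m xi k) + eta k.
  move=> kn; rewrite /e (douglas_step_error Qu u (US k.+1 _ (tT _ kn))) //=.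
  rewrite residual_splitting ?gt_eqF // defect_transfer -[RHS]addrA.
  by congr (_ + _); rewrite mulmxDr addrC.
pose X := (1 - L / 2)^-1 * (s.+1%:R * C * dt ^+ 2).
pose Y := (1 - L / 2)^-1 * (s.+1%:R * (3 * C) * dt ^+ 3).
pose H := M ^+ s * (s.+1%:R * (2 * C) * dt ^+ 3).
have X0 : 0 <= X by rewrite !mulr_ge0 ?exprn_ge0.
have Y0 : 0 <= Y by rewrite !mulr_ge0 ?exprn_ge0.
have H0 : 0 <= H by rewrite !mulr_ge0 ?exprn_ge0.
have xiX k : (k < n)%N -> N (xi k) <= X.
  move=> kn; rewrite (seminormN sN); apply: le_trans (invmx_P0mx_le _) _.
  by rewrite ler_wpM2l // defect_le // tT.
have xiY k : (k < n)%N -> N (xi k - xi k.-1) <= Y.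
  case: k => [_|k kn]; first by rewrite subrr (seminorm0 sN).
  rewrite /xi /= -opprD (seminormN sN) -mulmxBr.
  apply: le_trans (invmx_P0mx_le _) _.
  by rewrite ler_wpM2l // defect_diff_le // tT.
have etaH k : (k < n)%N -> N (eta k) <= H.
  move=> kn; apply: le_trans (Qinvprod_le _ (leqnn s)) _.
  by rewrite ler_wpM2l ?exprn_ge0 // trapezoidal_residual_le // tT.
have := power_bounded_recursion sN RK e0 eS K_ge0 X0 H0 xiX xiY etaH.
move=> /le_trans; apply; rewrite /error_constant.
set cX := (1 - L / 2)^-1 * (s.+1%:R * C).
set cY := (1 - L / 2)^-1 * (s.+1%:R * (3 * C)).
set cH := M ^+ s * (s.+1%:R * (2 * C)).
have -> : X = cX * dt ^+ 2 by rewrite /X /cX !mulrA.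
have -> : Y = cY * dt ^+ 3 by rewrite /Y /cY !mulrA.
have -> : H = cH * dt ^+ 3 by rewrite /H /cH !mulrA.
(* The [n] forcing terms are of size [dt ^+ 3]; one factor [dt] is spent on [n%:R * dt <= T]. *)
have c0 : 0 <= K * (cH + K * cY) * dt ^+ 2.
  by rewrite !(mulr_ge0, addr_ge0) ?exprn_ge0.
have := ler_wpM2r c0 nT; rewrite -subr_ge0 => nT'.
rewrite -subr_ge0; apply: le_trans nT' _.
by rewrite le_eqVlt; apply/orP; left; apply/eqP; ring.
Qed.

End OneProblem.

(** * Uniform bounds *)

Section BigO.
Variables (R : realType) (T : R) (P : R -> linear_ivp R) (adm : R -> R -> Prop).
Implicit Types w : forall h : R, R -> R -> 'cV[R]_(ivp_dim (P h)).
Local Notation O1 := (@bigO1 R T P adm).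

Let sN h : is_seminorm (@vnorm R (P h)) := is_norm_seminorm (vnormP (P h)).

Lemma bigO1_eq w w' :
  (forall h dt t, adm h dt -> 0 <= t <= T -> w h dt t = w' h dt t) ->
  O1 w -> O1 w'.
Proof.
move=> ww' [C wC]; exists C => h dt t hdt tT.
by rewrite -ww' //; exact: wC.
Qed.

Lemma bigO10 : O1 (fun h _ _ => 0).
Proof. by exists 0 => h dt t _ _; rewrite (seminorm0 (sN h)). Qed.

Lemma bigO1D w w' : O1 w -> O1 w' -> O1 (fun h dt t => w h dt t + w' h dt t).
Proof.
move=> [C wC] [C' wC']; exists (C + C') => h dt t hdt tT.
by apply: (seminorm_leD (sN h)); [exact: wC|exact: wC'].
Qed.

Lemma bigO1Z (a : R) w : O1 w -> O1 (fun h dt t => a *: w h dt t).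
Proof.
move=> [C wC]; exists (`|a| * C) => h dt t hdt tT.
by rewrite (seminormZ (sN h)) ler_wpM2l //; exact: wC.
Qed.

(** Take the maximum over finitely many indices; starting it at 0 makes the constant nonnegative. *)
Lemma bigO1_uniform n (w : nat -> forall h : R, R -> R -> 'cV[R]_(ivp_dim (P h))) :
  (forall j, (j < n)%N -> O1 (w j)) ->
  exists2 C : R, 0 <= C & forall j h dt t, (j < n)%N -> adm h dt ->
    0 <= t <= T -> vnorm (w j h dt t) <= C.
Proof.
elim: n => [|n IH] wO; first by exists 0.
have [C C0 wC] := IH (fun j jn => wO j (ltnW jn)).
have [C' wC'] := wO n (ltnSn n).
exists (Num.max C C') => [|j h dt t]; first by rewrite le_max C0.
rewrite ltnS leq_eqVlt le_max => /orP[/eqP -> hdt tT|jn hdt tT].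
  by rewrite wC' ?orbT.
by rewrite wC.
Qed.

Section QProducts.
Variables (s j : nat) (v : forall h : R, R -> 'cV[R]_(ivp_dim (P h))).
Hypothesis dt_neq0 : forall h dt, adm h dt -> dt != 0.
Hypothesis hv : forall I : seq nat, (1 <= size I)%N ->
  path ltn 0%N (rcons I j) ->
  O1 (fun h dt t => dt ^+ (size I).-1 *: (invmx (Atotal s (P h)) *m
    (\big[mulmx/1%:M]_(i <- I) coef (P h) i) *m v h t)).

(* Expand one factor at a time: [A_I Q_k q = A_I q - dt/2 A_I A_k q]. *)
Lemma bigO1_coef_Qprod l k (I : seq nat) : (1 <= size I)%N ->
  path ltn 0%N (rcons I k) -> (k + l)%N = j ->
  O1 (fun h dt t => dt ^+ (size I).-1 *: (invmx (Atotal s (P h)) *m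
    (\big[mulmx/1%:M]_(i <- I) coef (P h) i) *m
    ((\big[mulmx/1%:M]_(i <- iota k l) Qmx (P h) dt i) *m v h t))).
Proof.
elim: l k I => [|l IH] k I sI Ik kl.
  rewrite addn0 in kl; rewrite kl in Ik.
  refine (bigO1_eq _ (hv sI Ik)) => h dt t _ _.
  by rewrite big_nil mul1mx.
have kl' : (k.+1 + l)%N = j by rewrite -kl addSnnS.
have Ik1 : path ltn 0%N (rcons I k.+1).
  by move: Ik; rewrite !rcons_path => /andP[-> /= /leqW].
have Ikk : path ltn 0%N (rcons (rcons I k) k.+1).
  by rewrite rcons_path Ik last_rcons /= ltnSn.
have sIk : (1 <= size (rcons I k))%N by rewrite size_rcons.
refine (bigO1_eq _ (bigO1D (IH _ _ sI Ik1 kl')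
  (bigO1Z (- 2^-1) (IH _ _ sIk Ikk kl')))) => h dt t _ _.
rewrite size_rcons big_mulmx_rcons /= big_cons.
set q := \big[mulmx/1%:M]_(i <- iota k.+1 l) _.
set A := invmx _; set B := \big[mulmx/1%:M]_(i <- I) _.
rewrite /Qmx mulmxBl mul1mx -scalemxAl mulmxBl -scalemxAl.
rewrite [A *m B *m (_ - _)]mulmxBr -scalemxAr scalerBr !scalerA.
congr (_ + _); rewrite -scaleNr !mulmxA; congr (_ *: _).
(* Appending [k] lengthens [I] by one, which accounts for the extra factor [dt] coming from
   [Q_k]. *)
by rewrite -[in LHS](prednK sI) exprS; ring.
Qed.

(** Peel off the first factor: [Q_k q - 1 = (q - 1) - dt/2 A_k q]. The [dt] cancels [dt^-1], leaving
    [bigO1_coef_Qprod] for the one-element list. *)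
Lemma bigO1_Qprod_sub1 l k : (1 <= k)%N -> (k + l)%N = j ->
  O1 (fun h dt t => dt^-1 *: (invmx (Atotal s (P h)) *m
    ((\big[mulmx/1%:M]_(i <- iota k l) Qmx (P h) dt i) - 1%:M)) *m v h t).
Proof.
elim: l k => [|l IH] k k1 kl.
  refine (bigO1_eq _ bigO10) => h dt t _ _.
  by rewrite big_nil subrr mulmx0 scaler0 mul0mx.
have kl' : (k.+1 + l)%N = j by rewrite -kl addSnnS.
have kk : path ltn 0%N (rcons [:: k] k.+1) by rewrite /= k1 ltnSn.
refine (bigO1_eq _ (bigO1D (IH _ (ltn0Sn k) kl')
  (bigO1Z (- 2^-1) (bigO1_coef_Qprod (I := [:: k]) (leqnn 1) kk kl')))) => h dt t hdt _.
rewrite !big_cons big_nil mulmx1 expr0 scale1r.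
set q := \big[mulmx/1%:M]_(i <- iota k.+1 l) _; set A := invmx _.
have -> : Qmx (P h) dt k *m q - 1%:M =
    (q - 1%:M) - (2^-1 * dt) *: (coef (P h) k *m q).
  by rewrite mulmxBl mul1mx -scalemxAl addrAC.
rewrite [A *m (q - 1%:M - _)]mulmxBr scalerBr [RHS]mulmxBl; congr (_ + _).
rewrite -scalemxAr scalerA mulrCA mulVf ?(dt_neq0 hdt) // mulr1.
by rewrite -scalemxAl !mulmxA scaleNr.
Qed.

End QProducts.

(** Mind the shift: [Qdefect j] contains [Q_1, ..., Q_j] and meets derivatives of [phi_(j+1)], so
    all its indices stay below [j.+1] as in (e). *)
Lemma bigO1_Qdefect s j (v : forall h : R, R -> 'cV[R]_(ivp_dim (P h))) :
  (forall h dt, adm h dt -> dt != 0) ->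
  (forall I : seq nat, (1 <= size I)%N -> path ltn 0%N (rcons I j.+1) ->
    O1 (fun h dt t => dt ^+ (size I).-1 *: (invmx (Atotal s (P h)) *m
      (\big[mulmx/1%:M]_(i <- I) coef (P h) i) *m v h t))) ->
  O1 (fun h dt t => Qdefect s (P h) dt j *m v h t).
Proof. by move=> dt0 hv; exact: (bigO1_Qprod_sub1 dt0 hv (leqnn 1)). Qed.

End BigO.

(** * Second-order convergence, uniformly in the mesh-width *)

Theorem theorem3p1 (R : realType) (s : nat) (T : R)
  (P : R -> linear_ivp R) (adm : R -> R -> Prop)
  (u : forall h : R, R -> 'cV[R]_(ivp_dim (P h)))
  (hs : (1 <= s)%N) (hT : 0 < T)
  (hadm : forall h dt, adm h dt -> 0 < h /\ 0 < dt)
  (hu : forall h dt, adm h dt -> exact_solution s T (u h))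
  (hphi : forall h dt, adm h dt -> forall j, (j <= s)%N ->
     twice_cont_diff_on T (phi (u h) j))
  (hA : forall h dt, adm h dt -> Atotal s (P h) \in unitmx)
  (hphi1 : forall j, (j <= s)%N ->
     bigO1 T adm (fun h _ t => deriv_on T (phi (u h) j) t))
  (hphi2 : forall j, (j <= s)%N ->
     bigO1 T adm (fun h _ t => deriv_on T (deriv_on T (phi (u h) j)) t))
  (ha : exists L M : R, [/\ L < 2, 0 < M &
     forall h dt, adm h dt ->
       mnorm (dt *: coef (P h) 0%N) <= L /\
       forall j, (1 <= j <= s)%N ->
         Qmx (P h) dt j \in unitmx /\ mnorm (invmx (Qmx (P h) dt j)) <= M])
  (hb : exists K : R, 0 < K /\
     forall h dt, adm h dt -> forall n, (1 <= n)%N ->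
       mnorm (Rmx s (P h) dt ^+ n) <= K)
  (hc : forall h dt, adm h dt -> forall j, (1 <= j <= s)%N ->
     coef (P h) 0%N *m coef (P h) j = coef (P h) j *m coef (P h) 0%N)
  (hd2 : bigO1 T adm (fun h _ t =>
     invmx (Atotal s (P h)) *m coef (P h) 0%N
       *m deriv_on T (deriv_on T (u h)) t))
  (hd3 : bigO1 T adm (fun h _ t =>
     invmx (Atotal s (P h)) *m coef (P h) 0%N
       *m deriv_on T (deriv_on T (deriv_on T (u h))) t))
  (* I = [:: i_1; ...; i_k]; the path condition says 0 < i_1 < ... < i_k < j *)
  (he1 : forall (I : seq nat) (j : nat), (1 <= size I)%N ->
     path ltn 0%N (rcons I j) -> (j <= s)%N ->
     bigO1 T adm (fun h dt t =>
       dt ^+ (size I).-1 *: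
         (invmx (Atotal s (P h)) *m (\big[mulmx/1%:M]_(i <- I) coef (P h) i)
            *m deriv_on T (phi (u h) j) t)))
  (he2 : forall (I : seq nat) (j : nat), (1 <= size I)%N ->
     path ltn 0%N (rcons I j) -> (j <= s)%N ->
     bigO1 T adm (fun h dt t =>
       dt ^+ (size I).-1 *:
         (invmx (Atotal s (P h)) *m (\big[mulmx/1%:M]_(i <- I) coef (P h) i)
            *m deriv_on T (deriv_on T (phi (u h) j)) t))) :
  convergent_order2 s T adm u.
Proof.
have [L [M [L2 M0 haLM]]] := ha.
have [K [K0 hbK]] := hb.
have dt_neq0 h dt : adm h dt -> dt != 0.
  by move=> /hadm[_ dt0]; rewrite gt_eqF.
have [C1 C10 phi2C] := bigO1_uniform (n := s.+1) hphi2.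
have [C2 C20 Gu2C] := bigO1_uniform (n := 1) (fun _ _ => hd2).
have [C3 C30 Gu3C] := bigO1_uniform (n := 1) (fun _ _ => hd3).
have [C4 C40 Qphi1C] := bigO1_uniform (n := s) (fun j (js : (j < s)%N) =>
  bigO1_Qdefect dt_neq0 (fun I sI Ij => he1 I j.+1 sI Ij js)).
have [C5 C50 Qphi2C] := bigO1_uniform (n := s) (fun j (js : (j < s)%N) =>
  bigO1_Qdefect dt_neq0 (fun I sI Ij => he2 I j.+1 sI Ij js)).
pose C := C1 + C2 + C3 + C4 + C5.
(* Condition (b) starts at [n = 1]; [K + 1] also covers the zeroth power, the identity. The
   threshold 1 for [dt] is an arbitrary choice. *)
exists (error_constant s T L M (K + 1) C), 1; split=> // h dt hdt _ U hU n.
move=> /andP[_ nT].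
have [A0L QM] := haLM h dt hdt; have [_ dt0] := hadm h dt hdt.
have hPu := hu h dt hdt; have hPphi := hphi h dt hdt.
have nP := vnormP (P h).
have mnorm_le (B : 'M[R]_(ivp_dim (P h))) (c : R) x :
    mnorm B <= c -> vnorm (B *m x) <= c * vnorm x.
  move=> Bc; apply: le_trans (norm_mulmx_le nP B x) _.
  by rewrite ler_wpM2r // (seminorm_ge0 (is_norm_seminorm nP)).
apply: douglas_error_le => //.
- by rewrite /C !addr_ge0.
- move=> j t js tT; have := phi2C j h dt t js hdt tT; rewrite /C; lra.
- move=> t tT; rewrite -(exact_deriv2E hT hPu hPphi tT).
  have := Gu2C 0%N h dt t isT hdt tT; rewrite /C; lra.
- move=> t tT; rewrite -(exact_deriv3E hT hPu hPphi tT).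
  have := Gu3C 0%N h dt t isT hdt tT; rewrite /C; lra.
- move=> j t js tT; have := Qphi1C j h dt t js hdt tT; rewrite /C; lra.
- move=> j t js tT; have := Qphi2C j h dt t js hdt tT; rewrite /C; lra.
- exact: hA h dt hdt.
- exact: ltW.
- by rewrite addr_ge0 // ltW.
- by move=> x; exact: mnorm_le.
- by move=> j js; have [] := QM j js.
- by move=> j x js; apply: mnorm_le; have [] := QM j js.
- move=> [|k] x; last first.
    by apply: mnorm_le; apply: le_trans (hbK h dt hdt k.+1 isT) _; rewrite lerDl.
  rewrite expr0 mul1mx mulrDl mul1r lerDr mulr_ge0 ?(ltW K0) //.
  exact: seminorm_ge0 (is_norm_seminorm nP) x.
- by move=> j js; exact: hc h dt hdt j js.
Qed.
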